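(* Consider a financial network without default cost in which all payment functions are monotone, piecewise-linear and strictly monotone. Then there is no claims trade (of a claim $e=(u,v)\in E$ to a buyer bank $w$, with any admissible return $\rho$) that strictly improves the assets of both the buyer $w$ and the creditor $v$ with respect to the minimal clearing state, i.e., there is no such trade with $\hat{a}^{\rho}_v>\hat{a}_v$ and $\hat{a}^{\rho}_w>\hat{a}_w$.
   Context: A financial network consists of a finite set $V$ of banks and a set $E$ of directed edges (claims) on $V$, with no self-loops and no parallel edges. An edge $e=(u,v)$ has debtor $u$, creditor $v$ and liability $\ell_e\ge0$. Each bank $v$ has external assets $a^{(x)}_v\ge0$. Let $E^+(v)=\{(v,w)\in E\}$, $E^-(v)=\{(u,v)\in E\}$, $L^+(v)=\sum_{e\in E^+(v)}\ell_e$. Each edge $e\in E^+(u)$ has a payment function $p_e:\mathbb{R}\to\mathbb{R}$ (payment on $e$ as a function of $u$'s assets) such that for all $a\ge0$, $\varepsilon>0$: $p_e(a)\in[0,\ell_e]$, $p_e(a)\le p_e(a+\varepsilon)$, $\sum_{e\in E^+(u)}p_e(a)=\min\{a,L^+(u)\}$. It is piecewise-linear if there are $k_e\ge1$, borders $0=x_{e,0}<\dots<x_{e,k_e}=L^+(u)<x_{e,k_e+1}=\infty$ and slopes $m_{e,i}\ge0$ with $p_e(a)=m_{e,i}(a-x_{e,i-1})+p_e(x_{e,i-1})$ on $[x_{e,i-1},x_{e,i})$. A payment function is strictly monotone if $p_e(a)<p_e(a+\varepsilon)$ for every $a\ge0$ and every $\varepsilon\in(0,\ell_e-a]$. In a network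 without default cost, a clearing state is a vector $\mathbf{a}\ge0$ with $a_v=a^{(x)}_v+\sum_{(u,v)\in E^-(v)}p_{(u,v)}(a_u)$ for all $v$; clearing states form a complete lattice under the coordinatewise order, and $\hat{\mathbf{a}}$ denotes its least element (minimal clearing state). Claims trade: given a claim $e=(u,v)\in E$, a buyer bank $w$ and a return $\rho$ with $0\le\rho\le\min\{a^{(x)}_w,\ell_e\}$, the post-trade network replaces edge $e$ by an edge $(u,w)$ with the same liability and the same payment function (as a function of $u$'s assets), decreases the external assets of $w$ to $a^{(x)}_w-\rho$ and increases those of $v$ to $a^{(x)}_v+\rho$, leaving everything else unchanged. $\hat{\mathbf{a}}^{\rho}$ denotes the minimal clearing state of the post-trade network. *)

(* Defs.v *)
From HB Require Import structures.
From mathcomp Require Import all_boot all_order all_algebra.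
From mathcomp Require Import boolp classical_sets reals.

Set Implicit Arguments.
Unset Strict Implicit.
Unset Printing Implicit Defensive.

Import Order.TTheory GRing.Theory Num.Theory.
Local Open Scope ring_scope.

(* The claims are given by a finite type C of labels together with their
   endpoints, so that moving a claim to another creditor makes sense even if
   this creates a parallel edge or a self-loop. Networks without self-loops
   and parallel edges are singled out by financial_network below; there, C is
   the same thing as a set of pairs of distinct banks. *)
Record network (R : realType) (V C : finType) := Network {
  debtor : C -> V;
  creditor : C -> V;
  liability : C -> R;
  external : V -> R;
  payment : C -> R -> R (* as a function of the assets of the debtor *)
}.

Section Definitions.
Variables (R : realType) (V C : finType).
Implicit Types (N : network R V C) (u v w : V) (e : C) (rho : R).

Definition total_liability N u : R :=
  \sum_(e | debtor N e == u) liability N e.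

Definition nonneg_data N : Prop :=
  (forall e, 0 <= liability N e) /\ (forall v, 0 <= external N v).

Definition valid_payments N : Prop :=
  [/\ forall e a, 0 <= a -> 0 <= payment N e a <= liability N e,
      forall e a eps, 0 <= a -> 0 < eps ->
        payment N e a <= payment N e (a + eps)
    & forall u a, 0 <= a ->
        \sum_(e | debtor N e == u) payment N e a
          = Num.min a (total_liability N u)].

Definition simple_graph N : Prop :=
  (forall e, debtor N e != creditor N e) /\
  injective (fun e => (debtor N e, creditor N e)).

Definition financial_network N : Prop :=
  [/\ simple_graph N, nonneg_data N & valid_payments N].

(* x i is the i-th border; m i is the slope on the piece that starts at x i,
   i.e. m_{e,i+1}. The last border x_{k+1} is infinite, so the last piece
   [x k, +oo[ is stated separately. *)
Definition piecewise_linear N e : Prop :=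
  exists (k : nat) (x m : nat -> R),
    [/\ (1 <= k)%N,
        [/\ x 0%N = 0, x k = total_liability N (debtor N e)
          & forall i, (i < k)%N -> x i < x i.+1],
        forall i, (i <= k)%N -> 0 <= m i,
        forall i a, (i < k)%N -> x i <= a -> a < x i.+1 ->
          payment N e a = m i * (a - x i) + payment N e (x i)
      & forall a, x k <= a ->
          payment N e a = m k * (a - x k) + payment N e (x k)].

(* Strictness is required up to the liability of e itself, not up to the
   total liability of the debtor. *)
Definition strictly_monotone N e : Prop :=
  forall a eps, 0 <= a -> 0 < eps -> eps <= liability N e - a ->
    payment N e a < payment N e (a + eps).

Definition incoming N (a : V -> R) v : R :=
  external N v + \sum_(e | creditor N e == v) payment N e (a (debtor N e)).

Definition clearing_state N (a : V -> R) : Prop :=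
  (forall v, 0 <= a v) /\ (forall v, a v = incoming N a v).

Definition minimal_clearing_state N (a : V -> R) : Prop :=
  clearing_state N a /\
  (forall b, clearing_state N b -> forall v, a v <= b v).

Definition admissible_return N e w rho : Prop :=
  0 <= rho <= Num.min (external N w) (liability N e).

Definition claims_trade N e w rho : network R V C :=
  Network (debtor N)
    (fun f => if f == e then w else creditor N f)
    (liability N)
    (fun x => external N x - (if x == w then rho else 0)
                           + (if x == creditor N e then rho else 0))
    (payment N).

(* With the two lemmas after it, this gives the existence of the minimal
   clearing state both before and after an admissible trade. *)
Lemma minimal_clearing_state_exists N :
  nonneg_data N -> valid_payments N -> exists a, minimal_clearing_state N a.
Proof.
move=> [_ ext0] [pay0 payS _].
have paymono e (s t : R) : 0 <= s -> s <= t -> payment N e s <= payment N e t.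
  move=> s0; rewrite le_eqVlt => /orP[/eqP -> //|st].
  by rewrite -(subrKC s t); apply: payS; rewrite ?subr_gt0.
have inc0 b : (forall v, 0 <= b v) -> forall v, 0 <= incoming N b v.
  move=> b0 v; apply: addr_ge0 => //; apply: sumr_ge0 => e _.
  by have /andP[] := pay0 e _ (b0 (debtor N e)).
have incmono b c : (forall v, 0 <= b v) -> (forall v, b v <= c v) ->
    forall v, incoming N b v <= incoming N c v.
  by move=> b0 bc v; apply: lerD => //; apply: ler_sum => e _; apply: paymono.
pose P b := (forall v, 0 <= b v) /\ (forall v, incoming N b v <= b v).
pose S v : set R := [set r | exists2 b, P b & r = b v]%classic.
pose top v := external N v + \sum_(e | creditor N e == v) liability N e.
have Ptop : P top.
  have top0 v : 0 <= top v.
    apply: addr_ge0 => //; apply: sumr_ge0 => e _.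
    by have /andP[] := pay0 e 0 (lexx 0); apply: le_trans.
  split=> // v; apply: lerD => //; apply: ler_sum => e _.
  by have /andP[] := pay0 e _ (top0 (debtor N e)).
have S0 v : (S v !=set0)%classic by exists (top v), top.
have Slb v : lbound (S v) 0 by move=> r [b [b0 _] ->].
pose a v := inf (S v).
have aP b : P b -> forall v, a v <= b v.
  by move=> Pb v; apply: ge_inf; [exists 0; exact: Slb|exists b].
have a0 v : 0 <= a v by apply: lb_le_inf.
have inca v : incoming N a v <= a v.
  apply: lb_le_inf => // r [b Pb ->]; apply: le_trans (proj2 Pb v).
  by apply: incmono => //; apply: aP.
exists a; split.
  split=> // v; apply/eqP; rewrite eq_le inca andbT.
  by apply: aP; split=> x; [apply: inc0|apply: incmono => //; apply: inc0].
by move=> b [b0 bE]; apply: aP; split=> // v; rewrite -bE.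
Qed.

Lemma claims_trade_nonneg N e w rho :
  nonneg_data N -> admissible_return N e w rho ->
  nonneg_data (claims_trade N e w rho).
Proof.
move=> [l0 ext0] /andP[rho0]; rewrite le_min => /andP[rhow _].
split=> //= v; apply: addr_ge0; last by case: ifP.
by case: eqP => [->|_]; rewrite ?subr0 // subr_ge0.
Qed.

Lemma claims_trade_valid N e w rho :
  valid_payments N -> valid_payments (claims_trade N e w rho).
Proof. by []. Qed.

End Definitions.

(* Main.v *)
Require Import Defs.
From mathcomp Require Import all_boot all_order all_algebra.
From mathcomp Require Import boolp classical_sets reals.
From mathcomp Require Import lra.
Import Order.TTheory GRing.Theory Num.Theory.
Local Open Scope ring_scope.

(** Suppose a trade improves both the creditor and the buyer, and let [a], [b]
    be the minimal clearing states before and after it. Then [min a b] is a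
    pre-fixed point of the old network, so [a <= b]. The trade only moves
    money between banks of [D = {x | a x < b x}], so by conservation of money
    the whole increase of assets in [D] is paid on, and stays within [D].
    Hence the left slopes of the payments at [b] form a column-stochastic
    matrix on [D], which has a nonzero invariant vector [pi >= 0]; for small
    [t > 0], [b - t * pi] is a clearing state after the trade,
    contradicting the minimality of [b]. *)

Lemma finite_pos_lower_bound (R : realType) (I : finType) (P : pred I)
    (F : I -> R) :
  (forall i, P i -> 0 < F i) ->
  exists d, 0 < d /\ forall i, P i -> d <= F i.
Proof.
move=> F0; exists (\big[Num.min/1]_(i | P i) F i); split.
  by apply: lt_bigmin.
by move=> i Pi; apply: bigmin_le_cond.
Qed.

Lemma le_sum_eq (R : realType) (I : finType) (F G : I -> R) :
  (forall i, F i <= G i) -> \sum_i G i <= \sum_i F i -> forall i, F i = G i.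
Proof.
move=> FG le_sum i; apply/esym/eqP; rewrite -subr_eq0; apply/eqP.
apply: (psumr_eq0P (P := predT) (F := fun i => G i - F i)) => //.
  by move=> j _; rewrite subr_ge0.
by apply/eqP; rewrite eq_le sumrB subr_le0 le_sum subr_ge0 ler_sum.
Qed.

(** The indicator of [D] is a left fixed vector of the flow matrix [A], so [A] also has a right
    fixed vector; its entrywise absolute value is the invariant flow. *)
Lemma invariant_flow (R : realType) (V C : finType) (src tgt : C -> V)
    (m : C -> R) (D : {set V}) (x0 : V) :
  x0 \in D -> (forall f, 0 <= m f) ->
  (forall f, src f \notin D -> m f = 0) ->
  (forall f, tgt f \notin D -> m f = 0) ->
  (forall y, y \in D -> \sum_(f | src f == y) m f = 1) ->
  exists pi : V -> R, [/\ forall x, 0 <= pi x, exists x, pi x != 0 &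
    forall x, \sum_(f | tgt f == x) m f * pi (src f) = pi x].
Proof.
move=> x0D m0 msrc mtgt msum.
have msum_le y : \sum_(f | src f == y) m f <= 1.
  have [/msum->//|yD] := boolP (y \in D).
  by rewrite big1 // => f /eqP fy; apply: msrc; rewrite fy.
pose A : 'M[R]_#|V| :=
  \matrix_(i, j) \sum_(f | (tgt f == enum_val i) && (src f == enum_val j)) m f.
pose z : 'rV[R]_#|V| := \row_i (enum_val i \in D)%:R.
(* Entry [j] of [z *m A] is the outflow of [j] into [D], which by [mtgt] is all of its outflow. *)
have zA : z *m A = z.
  apply/rowP => j; rewrite !mxE.
  transitivity (\sum_(f | src f == enum_val j) m f); last first.
    have [/msum->//|yD] := boolP (enum_val j \in D).
    by rewrite big1 // => f /eqP fy; apply: msrc; rewrite fy.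
  rewrite (partition_big (fun f => enum_rank (tgt f)) predT) //=.
  apply: eq_bigr => i _; rewrite !mxE mulr_sumr.
  rewrite [LHS](eq_bigl
    (fun f => (src f == enum_val j) && (enum_rank (tgt f) == i))).
    apply: eq_bigr => f /andP[_ /eqP fi]; rewrite -fi enum_rankK.
    by have [|/mtgt->] := boolP (tgt f \in D); rewrite ?mul1r ?mulr0.
  by move=> f; rewrite andbC -(inj_eq enum_val_inj) enum_rankK.
have [y y0 Ay] : exists2 y : 'cV[R]_#|V|, y != 0 & A *m y = y.
  (* [det0P] speaks of row vectors, so the transpose turns the left kernel vector [z] into a right
     one. *)
  have detA : \det (A - 1%:M)^T = 0.
    apply/eqP; rewrite det_tr; apply/det0P; exists z.
      apply/eqP => /rowP/(_ (enum_rank x0)).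
      by rewrite !mxE enum_rankK x0D => /eqP; rewrite oner_eq0.
    by rewrite mulmxBr mulmx1 zA subrr.
  move/eqP/det0P: detA => [v v0 /(congr1 trmx)].
  rewrite trmx_mul trmxK trmx0 mulmxBl mul1mx => /eqP; rewrite subr_eq0 => /eqP.
  by exists v^T; rewrite // trmx_eq0.
pose yf x := y (enum_rank x) 0.
have yfE x : \sum_(f | tgt f == x) m f * yf (src f) = yf x.
  rewrite -{2}/(yf x) /yf -{2}Ay mxE.
  rewrite (partition_big (fun f => enum_rank (src f)) predT) //=.
  apply: eq_bigr => j _; rewrite !mxE mulr_suml enum_rankK.
  rewrite [LHS](eq_bigl (fun f => (tgt f == x) && (src f == enum_val j))).
    by apply: eq_bigr => f /andP[_ /eqP->]; rewrite enum_valK.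
  by move=> f; rewrite -(inj_eq enum_val_inj) enum_rankK.
exists (fun x => `|yf x|); split=> //.
  case/matrix0Pn: y0 => i [j]; rewrite ord1 => yi; exists (enum_val i).
  by rewrite normr_eq0 /yf enum_valK.
(* [|y| <= A |y|] by the triangle inequality, and [A] does not increase
   total mass. *)
move=> x; apply/esym; move: x; apply: le_sum_eq.
  move=> x; rewrite -{1}yfE; apply: le_trans (ler_norm_sum _ _ _) _.
  by apply: ler_sum => f _; rewrite normrM ger0_norm.
rewrite [leLHS](_ : _ = \sum_f m f * `|yf (src f)|); last first.
  by rewrite [RHS](partition_big tgt predT).
rewrite (partition_big src predT) //=; apply: ler_sum => x _.
rewrite (eq_bigr (fun f => m f * `|yf x|)); last by move=> f /eqP->.
by rewrite -mulr_suml ler_piMl.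
Qed.

Section Payments.
Context {R : realType} {V C : finType} {N : network R V C}.
Hypothesis hN : valid_payments N.

Lemma payment_mono e (s t : R) :
  0 <= s -> s <= t -> payment N e s <= payment N e t.
Proof.
case: hN => _ payS _ s0; rewrite le_eqVlt => /orP[/eqP -> //|st].
by rewrite -(subrKC s t); apply: payS; rewrite ?subr_gt0.
Qed.

(** The payments of one debtor sum to a 1-Lipschitz function of its assets, and those on its other
    claims cannot decrease. *)
Lemma payment_lipschitz e (s t : R) :
  0 <= s -> s <= t -> payment N e t - payment N e s <= t - s.
Proof.
move=> s0 st; case: hN => _ _ paysum.
have := paysum (debtor N e) t (le_trans s0 st).
have := paysum (debtor N e) s s0.
rewrite (bigD1 e) //= [in X in _ -> X](bigD1 e) //=.
set A := \sum_(_ | _) _; set B := \sum_(_ | _) _.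
have AB : A <= B by apply: ler_sum => f _; apply: payment_mono.
by rewrite /Num.min; case: ltP => ?; case: ltP => ?; lra.
Qed.

Lemma payment_left_affine e (t : R) :
  piecewise_linear N e -> 0 < t -> t <= total_liability N (debtor N e) ->
  exists m d, [/\ 0 <= m, 0 < d, d <= t & forall s, 0 <= s -> s <= d ->
    payment N e (t - s) = payment N e t - m * s].
Proof.
move=> [k [x [m [k1 [x0 xk xS] m0 lin _]]]] t0 tL.
(* The first border at or above [t] puts [t] into some [(x i, x i.+1]], so a single affine piece
   lies just left of [t]. *)
have [j tj minj] : exists2 j, t <= x j & forall i, t <= x i -> (j <= i)%N.
  have ex_j : exists j, t <= x j by exists k; rewrite xk.
  by case: (ex_minnP ex_j) => j; exists j.
have jk : (j <= k)%N by apply: minj; rewrite xk.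
case: j => [|i] in tj minj jk *; first by move: tj; rewrite x0; lra.
have xi_t : x i < t.
  by rewrite ltNge; apply/negP => /minj; rewrite ltnn.
have xi0 : 0 <= x i.
  elim: i {tj minj xi_t} jk => [|i IH] ik; first by rewrite x0.
  by rewrite (le_trans (IH (ltnW ik))) // ltW // xS // ltnW.
have linS s : 0 < s -> s <= t - x i ->
    payment N e (t - s) = m i * (t - s - x i) + payment N e (x i).
  by move=> s0 sd; apply: lin => //; lra.
have mi0 : 0 <= m i by apply: m0; apply: ltnW.
(* The pieces are half-open, so the value at the right end of a piece comes
   from continuity. *)
have linT : payment N e t = m i * (t - x i) + payment N e (x i).
  apply/eqP; rewrite -subr_eq0; set q := _ - _; apply/negPn/negP => q0.
  have qpos : 0 < `|q| by rewrite normr_gt0.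
  have qs s : 0 < s -> s <= t - x i -> `|q| <= (1 + m i) * s.
    move=> s0 sd; have p := linS s s0 sd.
    have ts : 0 <= t - s by lra.
    have ts_t : t - s <= t by lra.
    have := payment_lipschitz e (t - s) t ts ts_t.
    have := payment_mono e (t - s) t ts ts_t.
    rewrite p.
    have mis : 0 <= m i * s by rewrite mulr_ge0 // ltW.
    by rewrite ler_norml /q; nra.
  (* This [s] makes the bound in [qs] at most half of [|q|]. *)
  pose s := Num.min (t - x i) (`|q| / (2 * (1 + m i))).
  have s0 : 0 < s by rewrite lt_min divr_gt0 ?mulr_gt0 ?subr_gt0 //; lra.
  have := qs s s0; rewrite ge_min lexx => /(_ isT).
  have : s * (2 * (1 + m i)) <= `|q|.
    by rewrite -ler_pdivlMr ?ge_min ?lexx ?orbT //; lra.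
  lra.
exists (m i), (t - x i); split=> //; rewrite ?subr_gt0 //; first lra.
move=> s; rewrite le_eqVlt => /orP[/eqP<-|s0 sd]; first by rewrite subr0 mulr0 subr0.
by rewrite linS // linT; lra.
Qed.

(** Knaster-Tarski: the infimum of all pre-fixed points is a clearing state, and [c] is one of
    them. *)
Lemma prefixpoint_ge_clearing_state (c : V -> R) :
  nonneg_data N -> (forall v, 0 <= c v) -> (forall v, incoming N c v <= c v) ->
  exists2 m, clearing_state N m & forall v, m v <= c v.
Proof.
move=> [_ ext0] c0 cpre.
have [pay0 _ _] := hN.
have inc0 b : (forall v, 0 <= b v) -> forall v, 0 <= incoming N b v.
  move=> b0 v; apply: addr_ge0 => //; apply: sumr_ge0 => e _.
  by have /andP[] := pay0 e _ (b0 (debtor N e)).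
have inc_mono b b' : (forall v, 0 <= b v) -> (forall v, b v <= b' v) ->
    forall v, incoming N b v <= incoming N b' v.
  by move=> b0 bb v; rewrite lerD2l; apply: ler_sum => e _; apply: payment_mono.
pose P b := (forall v, 0 <= b v) /\ (forall v, incoming N b v <= b v).
pose S v : set R := [set r | exists2 b, P b & r = b v]%classic.
have Slb v : lbound (S v) 0 by move=> r [b [b0 _] ->].
pose m v := inf (S v).
have m_le b : P b -> forall v, m v <= b v.
  by move=> Pb v; apply: ge_inf; [exists 0; exact: Slb|exists b].
have S0 v : (S v !=set0)%classic by exists (c v), c.
have m0 v : 0 <= m v by apply: lb_le_inf.
have incm v : incoming N m v <= m v.
  apply: lb_le_inf => // r [b Pb ->]; apply: le_trans (proj2 Pb v).
  by apply: inc_mono => //; apply: m_le.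
exists m; last exact: m_le.
split=> // v; apply/eqP; rewrite eq_le incm andbT.
by apply: m_le; split=> x; [apply: inc0|apply: inc_mono => //; apply: inc0].
Qed.

End Payments.

Theorem theorem3 (R : realType) (V C : finType) (N : network R V C)
    (hN : financial_network N)
    (hpl : forall e : C, piecewise_linear N e)
    (hsm : forall e : C, strictly_monotone N e)
    (a : V -> R) (ha : minimal_clearing_state N a) :
  ~ exists (e : C) (w : V) (rho : R) (arho : V -> R),
      [/\ admissible_return N e w rho,
          minimal_clearing_state (claims_trade N e w rho) arho,
          a (creditor N e) < arho (creditor N e)
        & a w < arho w].
Proof.
case=> e [w [rho [b [_ hb abv abw]]]].
case: hN => _ ndN vN; have [_ _ paysum] := vN.
case: ha => -[a0 aE] amin; case: hb => -[b0 bE] bmin.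
pose tgt f := if f == e then w else creditor N f.
have ab : forall x, a x <= b x.
  pose c x := Num.min (a x) (b x).
  have c0 x : 0 <= c x by rewrite le_min a0 b0.
  have mono_a x : incoming N c x <= a x.
    rewrite aE lerD2l; apply: ler_sum => f _; apply: payment_mono => //.
    by rewrite ge_min lexx.
  have c_pre x : incoming N c x <= c x.
    rewrite [leRHS]/c le_min mono_a /=.
    (* At the buyer and the creditor [a < b], so the bound by [a] suffices; at any other bank the
       trade changes neither external assets nor incoming claims. *)
    have [->|xw] := eqVneq x w; first exact: le_trans (mono_a w) (ltW abw).
    have [->|xv] := eqVneq x (creditor N e).
      exact: le_trans (mono_a _) (ltW abv).
    rewrite bE /incoming /= (negPf xw) (negPf xv) subr0 addr0 lerD2l.
    rewrite [leRHS](eq_bigl (fun f => creditor N f == x)).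
      apply: ler_sum => f _; apply: payment_mono => //.
      by rewrite ge_min lexx orbT.
    move=> f; case: (eqVneq f e) => // ->.
    by rewrite !(eq_sym _ x) (negPf xw) (negPf xv).
  have [m mclear mc] := prefixpoint_ge_clearing_state vN c ndN c0 c_pre.
  move=> x; apply: le_trans (amin _ mclear x) (le_trans (mc x) _).
  by rewrite ge_min lexx orbT.
pose L := total_liability N.
pose dp f := payment N f (b (debtor N f)) - payment N f (a (debtor N f)).
have dp0 f : 0 <= dp f by rewrite subr_ge0 payment_mono.
pose D := [set x | a x < b x].
(* A bank outside [D] has equal assets in both states and no part in the trade, so its nonnegative
   extra receipts sum to zero. *)
have dp_tgt f : tgt f \notin D -> dp f = 0.
  set x := tgt f; rewrite inE -leNgt => ba.
  have xw : x != w by apply: contraTneq ba => ->; rewrite -ltNge.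
  have xv : x != creditor N e by apply: contraTneq ba => ->; rewrite -ltNge.
  have {}ba : b x = a x by apply: le_anti; rewrite ba ab.
  have : \sum_(g | tgt g == x) dp g = 0.
    move: ba; rewrite bE aE /incoming /= (negPf xw) (negPf xv) subr0 addr0.
    move/addrI => ba; rewrite sumrB; apply/eqP; rewrite subr_eq0 ba.
    apply/eqP/eq_bigl => g; rewrite /tgt; case: (eqVneq g e) => // ->.
    by rewrite !(eq_sym _ x) (negPf xw) (negPf xv).
  by move/psumr_eq0P => -> //.
(* Summed over all banks, the two occurrences of [rho] cancel, and each claim is counted once
   whoever holds it. *)
have sum_ab : \sum_x (b x - a x) = \sum_f dp f.
  rewrite /dp !sumrB.
  rewrite (eq_bigr _ (fun x _ => bE x)).
  rewrite [in X in _ - X = _](eq_bigr _ (fun x _ => aE x)).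
  rewrite /incoming /= !big_split /=.
  rewrite -!big_mkcond /= !big_pred1_eq.
  rewrite [X in _ + X - _](_ : _ = \sum_f payment N f (b (debtor N f)));
    last by rewrite [RHS](partition_big tgt predT).
  rewrite [X in _ - (_ + X)](_ : _ = \sum_f payment N f (a (debtor N f)));
    last by rewrite [RHS](partition_big (creditor N) predT).
  rewrite sumrN -big_mkcond big_pred1_eq; lra.
(* Capping at [L y] is 1-Lipschitz, so [<=] holds at each bank; conservation of the total forces
   equality. *)
have min_ab y : Num.min (b y) (L y) - Num.min (a y) (L y) = b y - a y.
  move: y; apply: le_sum_eq.
    by move=> y; have := ab y; rewrite /Num.min; case: ltP => ?; case: ltP => ?; lra.
  rewrite sum_ab (partition_big (debtor N) predT) //=.
  apply: ler_sum => y _; rewrite -!paysum // -sumrB le_eqVlt; apply/orP; left.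
  by apply/eqP/eq_bigr => f /eqP fy; rewrite /dp fy.
have bL y : y \in D -> b y <= L y.
  by rewrite inE; have := min_ab y; rewrite /Num.min; case: ltP => ?; case: ltP => ?; lra.
have /choice[md mdP] : forall f, exists p : R * R, debtor N f \in D ->
    [/\ 0 <= p.1, 0 < p.2, p.2 <= b (debtor N f) &
     forall s, 0 <= s -> s <= p.2 ->
       payment N f (b (debtor N f) - s) =
       payment N f (b (debtor N f)) - p.1 * s].
  move=> f.
  have [fD|fD] := boolP (debtor N f \in D); last by exists (0, 0).
  have bf : 0 < b (debtor N f).
    by move: fD; rewrite inE; apply: le_lt_trans.
  have [m [d mdP]] := payment_left_affine vN f _ (hpl f) bf (bL _ fD).
  by exists (m, d).
pose m f := if debtor N f \in D then (md f).1 else 0.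
have [d1 [d10 d1P]] := finite_pos_lower_bound _ _
  [pred f | debtor N f \in D] (fun f => (md f).2)
  (fun f fD => let: And4 _ d0 _ _ := mdP f fD in d0).
have [d2 [d20 d2P]] : exists d, 0 < d /\ forall y, y \in D -> d <= b y - a y.
  by apply: finite_pos_lower_bound => y; rewrite inE subr_gt0.
(* [d1] keeps all affine formulas valid, and [d2] keeps [b - d] above [a] on [D]. *)
pose d := Num.min d1 d2.
have d0 : 0 < d by rewrite lt_min d10.
have affine f s : 0 <= s -> s <= d -> debtor N f \in D ->
    payment N f (b (debtor N f) - s) = payment N f (b (debtor N f)) - m f * s.
  move=> s0; rewrite le_min => /andP[sd _] fD; rewrite /m fD.
  by have [_ _ _ ->] := mdP f fD; rewrite // (le_trans sd) ?d1P.
have d_ab y : y \in D -> a y <= b y - d.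
  have : d <= d2 by rewrite ge_min lexx orbT.
  by move=> dd2 /d2P; lra.
have m0 f : 0 <= m f.
  by rewrite /m; case: ifP => // /mdP[].
have msrc f : debtor N f \notin D -> m f = 0 by rewrite /m => /negPf->.
(* If [dp f = 0], the payment is constant between [a] and [b], hence on the last stretch of length
   [d]. *)
have mtgt f : tgt f \notin D -> m f = 0.
  have [fD /dp_tgt|/msrc//] := boolP (debtor N f \in D); rewrite /dp => dpf.
  have bd := d_ab _ fD.
  have := payment_mono vN f _ _ (a0 (debtor N f)) bd.
  rewrite (affine f d (ltW d0) (lexx d) fD) => le_p; apply/eqP; rewrite eq_le m0 andbT.
  by rewrite -(pmulr_lle0 _ d0); lra.
(* Both [b y - d] and [b y] are at most [L y], so lowering the assets by [d] lowers the total
   payment by exactly [d]. *)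
have msum y : y \in D -> \sum_(f | debtor N f == y) m f = 1.
  move=> yD; apply: (mulIf (lt0r_neq0 d0)); rewrite mul1r mulr_suml.
  have ybd : 0 <= b y - d by apply: le_trans (d_ab y yD).
  have := paysum y _ ybd; have := paysum y _ (b0 y).
  have := bL y yD => byL.
  rewrite !min_l //; last by rewrite (le_trans _ byL) // gerBl ltW.
  move=> sb sbd; transitivity (b y - (b y - d)); last by rewrite subKr.
  rewrite -{1}sb -sbd -sumrB; apply: eq_bigr => f /eqP fy.
  by rewrite -fy (affine f d) ?fy ?subKr // ltW.
have wD : w \in D by rewrite inE.
have [pi [pi0 [z piz] piE]] := invariant_flow _ _ _ _ _ _ _ _ wD m0 msrc mtgt msum.
have piD y : y \notin D -> pi y = 0.
  by move=> yD; rewrite -piE big1 // => f /eqP fy; rewrite mtgt ?mul0r // fy.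
pose S := \sum_x pi x.
have pi_le x : pi x <= S by rewrite /S (bigD1 x) //= lerDl sumr_ge0.
have S0 : 0 < S by apply: lt_le_trans (pi_le z); rewrite lt_def piz pi0.
(* Since [pi x <= S], this scaling keeps every decrease [t * pi x] within [d]. *)
pose t := d / S; have t0 : 0 < t by rewrite divr_gt0.
have t_le x : t * pi x <= d.
  by rewrite /t mulrAC ler_pdivrMr // ler_pM2l.
have tpi0 x : 0 <= t * pi x by rewrite mulr_ge0 // ltW.
pose c x := b x - t * pi x.
(* By [affine], receipts at [x] fall by [t] times the inflow of [pi], which [piE] equates with the
   fall of the assets. *)
have cP : clearing_state (claims_trade N e w rho) c.
  split=> x.
    have [xD|xD] := boolP (x \in D); last by rewrite /c piD // mulr0 subr0.
    by have := d_ab x xD; have := a0 x; have := t_le x; rewrite /c; lra.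
  rewrite {1}/c bE -piE /incoming -addrA; congr (_ + _).
  rewrite mulr_sumr -sumrB; apply: eq_bigr => f _ /=.
  have [fD|fD] := boolP (debtor N f \in D).
    by rewrite /c affine // mulrCA.
  by rewrite /c piD // !mulr0 !subr0.
have := bmin c cP z; rewrite /c.
have : 0 < t * pi z by rewrite mulr_gt0 // lt_def piz pi0.
lra.
Qed.
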